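(* Let $\mathcal{T}_1$ be an $\mathcal{ALC}$ TBox, $\mathcal{T}_2$ a Horn-$\mathcal{ALC}$ TBox, and $\Theta=(\Sigma_1,\Sigma_2)$ a pair of signatures. Then $\mathcal{T}_1$ $\Theta$-rCQ entails $\mathcal{T}_2$ if and only if for every tree-shaped $\Sigma_1$-ABox $\mathcal{A}$ of outdegree at most $|\mathcal{T}_2|$ that is consistent with both $\mathcal{T}_1$ and $\mathcal{T}_2$, the canonical model $\mathcal{I}_{\mathcal{T}_2,\mathcal{A}}$ is con-$\Sigma_2$-homomorphically embeddable into every model $\mathcal{I}_1$ of $(\mathcal{T}_1,\mathcal{A})$.
   Context: $\mathcal{ALC}$ concepts are built from concept names and $\top$ using $\neg,\sqcap,\exists R.C$; a TBox is a finite set of inclusions $C\sqsubseteq D$, $|\mathcal{T}|$ denotes its size; it is Horn-$\mathcal{ALC}$ if no $\neg C$ occurs negatively and no $\exists R.\neg C$ occurs positively. An ABox is a finite set of assertions $A(a)$, $R(a,b)$; a $\Sigma_1$-ABox uses only names from $\Sigma_1$. An ABox $\mathcal{A}$ is tree-shaped if the undirected graph with nodes $\mathsf{ind}(\mathcal{A})$ and edges $\{a,b\}$ for $R(a,b)\in\mathcal{A}$ is a tree, and $R(a,b)\in\mathcal{A}$ implies $S(a,b)\notin\mathcal{A}$ for $S\ne R$ and $S(b,a)\notin\mathcal{A}$ for all $S$; its outdegree is the maximal number of children of a node in this tree. Interpretations satisfy $a^{\mathcal{I}}=a$. For a consistent Horn-$\mathcal{ALC}$ KB $(\mathcal{T},\mathcal{A})$,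 the canonical model $\mathcal{I}_{\mathcal{T},\mathcal{A}}$ is the model obtained by the standard chase: (with $\mathcal{T}$ in normal form, consisting of inclusions $A\sqsubseteq B$, $A_1\sqcap A_2\sqsubseteq B$, $\exists R.A\sqsubseteq B$, $A\sqsubseteq\bot$, $\top\sqsubseteq B$, $A\sqsubseteq\exists R.B$, $A\sqsubseteq\forall R.B$ over concept names) exhaustively add to $\mathcal{A}$ the assertions forced by the inclusions, introducing for $A(a)$ and $A\sqsubseteq\exists R.B$ a fresh $R$-successor in $B$ when none exists, and take the resulting possibly infinite ABox as an interpretation; it is a forest-shaped model that on its own is complete for the KB for UCQ answering. CQs are conjunctions of atoms $A(z)$, $R(z,z')$ with answer variables; a CQ is rooted (rCQ) if every quantified variable is connected (ignoring edge direction) to an answer variable. $\mathcal{K}\models q(\vec a)$ means all models satisfy $q(\vec a)$. $\mathcal{T}_1$ $\Theta$-rCQ entails $\mathcal{T}_2$ if for every $\Sigma_1$-ABox $\mathcal{A}$ consistent with both TBoxes and every rCQ $q(\vec x)$ over names in $\Sigma_2$ and tuple $\vec a$ from $\mathsf{ind}(\mathcal{A})$, $(\mathcal{T}_2,\mathcal{A})\models q(\vec a)$ implies $(\mathcal{T}_1,\mathcal{A})\models q(\vec a)$. A $\Sigma_2$-homomorphism from $\mathcal{I}$ to $\mathcal{J}$ preserves membership in $\Sigma_2$-concept names and $\Sigma_2$-role names and fixes every individual of $\mathcal{A}$ in its domain. The maximal $\Sigma_2$-connected subinterpretation of $\mathcal{I}$ is its restriction to $\mathsf{ind}(\mathcal{A})$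 plus all elements reachable from an individual by a path of $\Sigma_2$-role edges; $\mathcal{I}$ is con-$\Sigma_2$-homomorphically embeddable into $\mathcal{J}$ if there is a $\Sigma_2$-homomorphism from its maximal $\Sigma_2$-connected subinterpretation into $\mathcal{J}$. *)

(* Defs.v *)
From HB Require Import structures.
From mathcomp Require Import all_boot.

Set Implicit Arguments.
Unset Strict Implicit.
Unset Printing Implicit Defensive.

(* Names: three countably infinite sets. *)
Definition cname := nat.
Definition rname := nat.
Definition iname := nat.

Inductive concept :=
| Top
| Name of cname
| Neg of concept
| And of concept & concept
| Ex of rname & concept.

Definition concept_comparable : comparable concept.
Proof. by rewrite /comparable /decidable; do 2!decide equality. Defined.
HB.instance Definition _ := hasDecEq.Build concept (compareP concept_comparable).

Definition Bot : concept := Neg Top.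
Definition All (R : rname) (C : concept) : concept := Neg (Ex R (Neg C)).

(* An element (C, D) is the inclusion C [= D.  Lists stand for finite sets:
   only membership matters, and the size below ignores repetitions. *)
Definition tbox := seq (concept * concept).

Fixpoint concept_size (C : concept) : nat :=
  match C with
  | Top => 1
  | Name _ => 1
  | Neg D => (concept_size D).+1
  | And D E => (concept_size D + concept_size E).+1
  | Ex _ D => (concept_size D).+2
  end.

(* Number of occurrences of symbols. *)
Definition tbox_size (T : tbox) : nat :=
  \sum_(ci <- undup T) (concept_size ci.1 + concept_size ci.2).+1.

(* Occurrences of subconcepts with their polarity (true = positive).  As usual
   in the definition of Horn ontologies, the abbreviation All R D, that is,
   Neg (Ex R (Neg D)), counts as one constructor whose argument has the polarity
   of the whole; if its inner negation were counted as an occurrence, it would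
   be negative whenever All R D is positive, and the Horn normal form inclusions
   A [= All R B would not be Horn. *)
Fixpoint occurrences (p : bool) (C : concept) : seq (bool * concept) :=
  (p, C) ::
  match C with
  | Top | Name _ => [::]
  | Neg (Ex _ (Neg D)) => occurrences p D
  | Neg D => occurrences (~~ p) D
  | And D E => occurrences p D ++ occurrences p E
  | Ex _ D => occurrences p D
  end.

Definition occurs (p : bool) (C : concept) (T : tbox) : Prop :=
  exists2 ci, ci \in T &
    (p, C) \in occurrences false ci.1 ++ occurrences true ci.2.

Definition horn (T : tbox) : Prop :=
  (forall C, ~ occurs false (Neg C) T) /\
  (forall R C, ~ occurs true (Ex R (Neg C)) T).

Inductive assertion :=
| CAss of cname & iname
| RAss of rname & iname & iname.

Definition assertion_comparable : comparable assertion.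
Proof. by rewrite /comparable /decidable; do 2!decide equality. Defined.
HB.instance Definition _ :=
  hasDecEq.Build assertion (compareP assertion_comparable).

Definition abox := seq assertion.

Definition ind (A : abox) : seq iname :=
  flatten [seq match s with CAss _ a => [:: a] | RAss _ a b => [:: a; b] end
          | s <- A].

Record signature := Signature {
  sigC : cname -> Prop;
  sigR : rname -> Prop
}.

Definition sig_abox (S : signature) (A : abox) : Prop :=
  (forall B a, CAss B a \in A -> sigC S B) /\
  (forall R a b, RAss R a b \in A -> sigR S R).

Definition adj (A : abox) : rel iname := fun a b =>
  has (fun s => match s with
                | CAss _ _ => false
                | RAss _ c d => ((c == a) && (d == b)) || ((c == b) && (d == a))
                end) A.

Definition is_tree (V : seq iname) (e : rel iname) : Prop :=
  [/\ V != [::],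
      forall a b, a \in V -> b \in V ->
        exists2 p, path e a p & last a p = b
    & forall c, ucycle e c -> size c <= 2].

Definition tree_shaped (A : abox) : Prop :=
  [/\ is_tree (ind A) (adj A),
      forall R S a b, RAss R a b \in A -> S <> R -> RAss S a b \notin A
    & forall R S a b, RAss R a b \in A -> RAss S b a \notin A].

(* In the tree with root r, c is a child of its neighbour b iff b can be reached
   from r without visiting c. *)
Definition child (A : abox) (r b c : iname) : Prop :=
  adj A b c /\ exists p, [/\ path (adj A) r p, last r p = b & c \notin r :: p].

(* The root of the tree may be chosen. *)
Definition outdegree_le (k : nat) (A : abox) : Prop :=
  exists2 r, r \in ind A &
    forall b cs, b \in ind A -> uniq cs ->
      (forall c, c \in cs -> child A r b c) -> size cs <= k.

(* Standard names: the domain consists of the individual names, which denote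
   themselves, and of further anonymous elements. *)
Record interp := Interp {
  anon : Type;
  cint : cname -> iname + anon -> Prop;
  rint : rname -> iname + anon -> iname + anon -> Prop
}.

Definition dom (I : interp) : Type := (iname + anon I)%type.
Definition indiv (I : interp) (a : iname) : dom I := inl a.

Fixpoint cext (I : interp) (C : concept) (d : dom I) : Prop :=
  match C with
  | Top => True
  | Name A => cint A d
  | Neg D => ~ cext D d
  | And D E => cext D d /\ cext E d
  | Ex R D => exists2 e : dom I, rint R d e & cext D e
  end.

Definition sat_tbox (I : interp) (T : tbox) : Prop :=
  forall C D, (C, D) \in T -> forall d : dom I, cext C d -> cext D d.

Definition sat_abox (I : interp) (A : abox) : Prop :=
  (forall B a, CAss B a \in A -> cint B (indiv I a)) /\
  (forall R a b, RAss R a b \in A -> rint R (indiv I a) (indiv I b)).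

Definition model (T : tbox) (A : abox) (I : interp) : Prop :=
  sat_tbox I T /\ sat_abox I A.

Definition consistent (T : tbox) (A : abox) : Prop := exists I, model T A I.

Definition var := nat.

Inductive atom :=
| CAtom of cname & var
| RAtom of rname & var & var.

Definition atom_comparable : comparable atom.
Proof. by rewrite /comparable /decidable; do 2!decide equality. Defined.
HB.instance Definition _ := hasDecEq.Build atom (compareP atom_comparable).

(* All variables of the atoms that are not answer variables are existentially
   quantified. *)
Record cq := CQ { answer : seq var; atoms : seq atom }.

Definition atom_vars (t : atom) : seq var :=
  match t with CAtom _ x => [:: x] | RAtom _ x y => [:: x; y] end.

Definition quantified (q : cq) (x : var) : bool :=
  (x \in flatten (map atom_vars (atoms q))) && (x \notin answer q).

Inductive qconnected (q : cq) (x : var) : var -> Prop :=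
| qconn_refl : qconnected q x x
| qconn_fwd R y z :
    qconnected q x y -> RAtom R y z \in atoms q -> qconnected q x z
| qconn_bwd R y z :
    qconnected q x y -> RAtom R z y \in atoms q -> qconnected q x z.

Definition rooted (q : cq) : Prop :=
  forall y, quantified q y -> exists2 x, x \in answer q & qconnected q x y.

Definition sig_cq (S : signature) (q : cq) : Prop :=
  (forall B x, CAtom B x \in atoms q -> sigC S B) /\
  (forall R x y, RAtom R x y \in atoms q -> sigR S R).

Definition sat_cq (I : interp) (q : cq) (a : seq iname) : Prop :=
  exists2 v : var -> dom I,
    map v (answer q) = map (indiv I) a &
    (forall B x, CAtom B x \in atoms q -> cint B (v x)) /\
    (forall R x y, RAtom R x y \in atoms q -> rint R (v x) (v y)).

Definition entails_cq (T : tbox) (A : abox) (q : cq) (a : seq iname) : Prop :=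
  forall I, model T A I -> sat_cq I q a.

Definition rcq_entails (Theta : signature * signature) (T1 T2 : tbox) : Prop :=
  forall A, sig_abox Theta.1 A -> consistent T1 A -> consistent T2 A ->
  forall (q : cq) (a : seq iname),
    rooted q -> sig_cq Theta.2 q ->
    size a = size (answer q) -> {subset a <= ind A} ->
    entails_cq T2 A q a -> entails_cq T1 A q a.

(* Normal form inclusions.  The names occurring in them are indexed by concepts:
   the index Name A is the concept name A itself, and any other index C is the
   fresh name that the normalisation introduces for the subconcept C. *)
Inductive nci :=
| NSub of concept & concept               (* A [= B *)
| NAnd of concept & concept & concept     (* A1 |^| A2 [= B *)
| NExL of rname & concept & concept       (* Ex R A [= B *)
| NBot of concept                         (* A [= Bot *)
| NTop of concept                         (* Top [= B *)
| NExR of concept & rname & concept       (* A [= Ex R B *)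
| NAll of concept & rname & concept.      (* A [= All R B *)

Definition nci_comparable : comparable nci.
Proof.
move=> x y; rewrite /decidable.
by decide equality; (apply: concept_comparable || decide equality).
Defined.
HB.instance Definition _ := hasDecEq.Build nci (compareP nci_comparable).

(* Inclusions making (the name for) C subsume C. *)
Fixpoint norm_neg (C : concept) : seq nci :=
  match C with
  | Top => [:: NTop Top]
  | Name _ => [::]
  | And D E => NAnd D E C :: norm_neg D ++ norm_neg E
  | Ex R D => NExL R D C :: norm_neg D
  | Neg _ => [::]  (* does not occur negatively in a Horn TBox *)
  end.

(* Inclusions making (the name for) C subsumed by C. *)
Fixpoint norm_pos (C : concept) : seq nci :=
  match C with
  | Top | Name _ => [::]
  | And D E => [:: NSub C D, NSub C E & norm_pos D ++ norm_pos E]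
  | Ex R D => NExR C R D :: norm_pos D
  | Neg (Ex R (Neg D)) => NAll C R D :: norm_pos D
  | Neg D => [:: NAnd C D Bot, NBot Bot & norm_neg D]
  end.

Definition normal_form (T : tbox) : seq nci :=
  flatten [seq NSub ci.1 ci.2 :: norm_neg ci.1 ++ norm_pos ci.2 | ci <- T].

(* Elements of the chase: individuals, and Succ t R B, the fresh R-successor in B
   introduced for t. *)
Inductive elt :=
| Ind of iname
| Succ of elt & rname & concept.

Record cstate := CState {
  cdom : elt -> Prop;
  cfact : concept -> elt -> Prop;
  rfact : rname -> elt -> elt -> Prop
}.

(* All individual names belong to the domain of every interpretation; those
   outside ind A carry no assertion. *)
Definition chase_init (A : abox) : cstate := CState
  (fun t => exists a, t = Ind a)
  (fun C t => exists B a, [/\ C = Name B, t = Ind a & CAss B a \in A])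
  (fun R t u => exists a b, [/\ t = Ind a, u = Ind b & RAss R a b \in A]).

Section ChaseStep.
Variables (N : seq nci) (s : cstate).

Definition needs_succ (t : elt) (R : rname) (B : concept) : Prop :=
  (exists2 A, NExR A R B \in N & cfact s A t) /\
  ~ (exists2 u, rfact s R t u & cfact s B u).

Inductive step_dom : elt -> Prop :=
| sd_old t : cdom s t -> step_dom t
| sd_new t R B : needs_succ t R B -> step_dom (Succ t R B).

Inductive step_rfact : rname -> elt -> elt -> Prop :=
| sr_old R t u : rfact s R t u -> step_rfact R t u
| sr_new t R B : needs_succ t R B -> step_rfact R t (Succ t R B).

Inductive step_cfact : concept -> elt -> Prop :=
| sc_old B t : cfact s B t -> step_cfact B t
| sc_sub A B t : NSub A B \in N -> cfact s A t -> step_cfact B t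
| sc_and A1 A2 B t : NAnd A1 A2 B \in N ->
    cfact s A1 t -> cfact s A2 t -> step_cfact B t
| sc_exl R A B t u : NExL R A B \in N ->
    rfact s R t u -> cfact s A u -> step_cfact B t
| sc_top B t : NTop B \in N -> cdom s t -> step_cfact B t
| sc_all A R B t u : NAll A R B \in N ->
    cfact s A t -> rfact s R t u -> step_cfact B u
| sc_new t R B : needs_succ t R B -> step_cfact B (Succ t R B).

(* Every applicable rule is applied simultaneously, so that iterating the step is
   a fair exhaustive chase.  Inclusions A [= Bot never apply to a consistent
   knowledge base and add nothing. *)
Definition chase_step : cstate := CState step_dom step_cfact step_rfact.

End ChaseStep.

Definition chase (T : tbox) (A : abox) (n : nat) : cstate :=
  iter n (chase_step (normal_form T)) (chase_init A).

Definition is_succ (t : elt) : bool :=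
  if t is Succ _ _ _ then true else false.

Definition chase_null (T : tbox) (A : abox) : Type :=
  {t : elt | is_succ t /\ exists n, cdom (chase T A n) t}.

Definition chase_elt (T : tbox) (A : abox) (d : iname + chase_null T A) : elt :=
  match d with inl a => Ind a | inr t => proj1_sig t end.

Definition canonical_model (T : tbox) (A : abox) : interp := @Interp
  (chase_null T A)
  (fun B d => exists n, cfact (chase T A n) (Name B) (chase_elt d))
  (fun R d e => exists n, rfact (chase T A n) R (chase_elt d) (chase_elt e)).

(* Domain of the maximal S-connected subinterpretation. *)
Inductive con_dom (S : signature) (A : abox) (I : interp) : dom I -> Prop :=
| con_ind a : a \in ind A -> con_dom S A (indiv I a)
| con_step R d e : con_dom S A d -> sigR S R -> rint R d e -> con_dom S A e.

(* h is an S-homomorphism to J from the restriction of I to the subset P of its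
   domain; the values of h outside P are irrelevant. *)
Definition sig_hom (S : signature) (A : abox) (I J : interp)
    (P : dom I -> Prop) (h : dom I -> dom J) : Prop :=
  [/\ forall B d, sigC S B -> P d -> cint B d -> cint B (h d),
      forall R d e, sigR S R -> P d -> P e -> rint R d e -> rint R (h d) (h e)
    & forall a, a \in ind A -> P (indiv I a) -> h (indiv I a) = indiv J a].

Definition con_hom_embeddable (S : signature) (A : abox) (I J : interp) : Prop :=
  exists h : dom I -> dom J, sig_hom S A (@con_dom S A I) h.

(* Main.v *)
From mathcomp Require Import all_boot boolp classical_sets cardinality filter.
Require Import Defs.

(** From entailment to embeddings: keeping only ABox edges and one witness per
    existential subconcept of [T1] turns a model of [T1] and [A] into a finitely
    branching one.  Every finite connected part of the chase is a rooted query that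
    [T2] entails, so it has a match in that model.  Finite branching leaves finitely
    many possible images for each element of the chase, so the matches of larger and
    larger parts have a limit along an ultrafilter.

    From embeddings to entailment: a query that [T2] entails over an arbitrary ABox
    [A] has a match in a finite round of the chase, which consists of [A] and of trees
    hanging off its individuals.  Up to any fixed round, the tree at [b] depends only
    on a finite tree-shaped unravelling of [A] at [b] that keeps, for each inclusion
    [Ex R D [= C] or [D [= All R C], one neighbour where [D] is derived earliest.  The
    hypothesis on that unravelling, applied to a model of [T1] and [A] with renamed
    individuals, maps the tree at [b] into the given model. *)

Set Implicit Arguments.
Unset Strict Implicit.
Unset Printing Implicit Defensive.

Local Open Scope classical_set_scope.

Lemma ultra_finite_range (X Y : Type) (U : set_system X) (F : set Y) (w : X -> Y) :
  UltraFilter U -> finite_set F -> (\forall x \near U, F (w x)) ->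
  exists2 y, F y & \forall x \near U, w x = y.
Proof.
elim/Pchoice: Y => Y in F w * => UU /finite_seqP[s ->].
elim: s => [|y s IHs] Uw; first by have [] := filter_ex Uw.
have [Uy|Uny] := in_ultra_setVsetC [set x | w x = y] UU.
  by exists y; rewrite //= mem_head.
have [|z zs Uz] := IHs; last by exists z; rewrite //= inE zs orbT.
by apply: filterS (filterI Uw Uny) => x [/=]; rewrite inE => /predU1P[].
Qed.

Lemma ultralimit_exists (I X Y : Type) (G : set_system X) (D : set I)
    (F : I -> set Y) (w : X -> I -> Y) :
  ProperFilter G ->
  (forall i, D i -> finite_set (F i)) ->
  (forall i, D i -> \forall x \near G, F i (w x i)) ->
  exists (U : set_system X) (f : I -> Y),
    [/\ ProperFilter U, G `<=` U & forall i, D i -> \forall x \near U, w x i = f i].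
Proof.
move=> GG Ffin GF; have [U [UU GU]] := ultraFilterLemma GG.
have [x0 _] : exists x, [set: X] x by apply: (@filter_ex _ U); apply: filterT.
have lim i : exists y, D i -> \forall x \near U, w x i = y.
  case: (pselect (D i)) => Di; last by exists (w x0 i).
  by have [y _ wy] := ultra_finite_range UU (Ffin i Di) (GU _ (GF i Di)); exists y.
by have [f fP] := choice lim; exists U, f; split=> //; exact: ultra_proper.
Qed.

Lemma injective_cancel (X Y : Type) (x0 : X) (f : X -> Y) :
  injective f -> exists g, cancel f g.
Proof.
move=> f_inj; have preimage y : exists x, forall z, f z = y -> z = x.
  case: (pselect (exists x, f x = y)) => [[x <-]|none]; first by exists x => z /f_inj.
  by exists x0 => z fz; case: none; exists z.
by have [g gP] := choice preimage; exists g => x; rewrite -(gP _ x).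
Qed.

Lemma common_stage (X : eqType) (P : nat -> X -> Prop) (s : seq X) :
  (forall m n x, m <= n -> P m x -> P n x) ->
  (forall x, x \in s -> exists n, P n x) ->
  exists n, forall x, x \in s -> P n x.
Proof.
move=> Pmono Ps.
have stages x : exists n, x \in s -> P n x.
  by case: (boolP (x \in s)) => [/Ps[n]|_]; [exists n | exists 0].
have [stage stageP] := choice stages.
exists (\max_(x <- s) stage x) => x xs.
by apply: Pmono (stageP x xs); apply: leq_bigmax_seq.
Qed.

Lemma earliest_witness (X : Type) (S : X -> Prop) (P : nat -> X -> Prop) :
  (forall m n x, m <= n -> P m x -> P n x) ->
  (exists n x, S x /\ P n x) ->
  exists2 x, S x & forall n y, S y -> P n y -> P n x.
Proof.
move=> Pmono exP; pose p n := `[< exists x, S x /\ P n x >].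
have exp : exists n, p n by have [n Pn] := exP; exists n; apply/asboolP.
case: (ex_minnP exp) => n /asboolP[x [Sx Px]] nmin; exists x => // m y Sy Py.
by apply: Pmono Px; apply: nmin; apply/asboolP; exists y.
Qed.

(** * Rooted trees *)

Section RootedTree.
Variables (X : choiceType) (e : rel X) (parent : X -> X) (height : X -> nat).
Hypothesis edge_parent : forall x y, e x y ->
  (parent x = y /\ height y < height x) \/ (parent y = x /\ height x < height y).

(* Both cycle neighbours of a vertex of maximal height are its parent. *)
Lemma size_parent_ucycle c : ucycle e c -> size c <= 2.
Proof.
case/andP=> ec Uc; rewrite leqNgt; apply/negP => c_gt2.
have [x xc xmax] : exists2 x, x \in c & forall y, y \in c -> height y <= height x.
  case: c c_gt2 {ec Uc} => // x0 c _; pose x1 := SeqSub (mem_head x0 c).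
  have [x _ xmax] := @arg_maxnP _ x1 predT (height \o val) isT.
  by exists (val x) => [|y yc]; [apply: valP | apply: (xmax (SeqSub yc))].
have [i c' rot_c] := rot_to xc.
have Ux : uniq (x :: c') by rewrite -rot_c rot_uniq.
have ex : cycle e (x :: c') by rewrite -rot_c rot_cycle.
have {xmax} xmax z : z \in x :: c' -> height z <= height x.
  by rewrite -rot_c mem_rot => /xmax.
have : 2 < size (x :: c') by rewrite -rot_c size_rot.
case: c' Ux ex xmax {rot_c} => [|y c'] //; case/lastP: c' => [|c' z] // Ux ex xmax _.
have [exy ezx] : e x y /\ e z x.
  by move: ex; rewrite /= !rcons_path last_rcons => /and3P[].
have parent_xy : parent x = y.
  by case: (edge_parent exy) => -[] // _; rewrite ltnNge xmax // !inE eqxx orbT.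
have parent_xz : parent x = z.
  case: (edge_parent ezx) => -[] // _.
  by rewrite ltnNge xmax // !inE mem_rcons mem_head !orbT.
by move: Ux; rewrite /= -parent_xy parent_xz mem_rcons mem_head andbF.
Qed.

(* The ancestors of the vertices reached without visiting z never include z. *)
Lemma parent_last_avoid r z p :
  parent r = r -> path e r p -> z \notin r :: p -> parent (last r p) <> z.
Proof.
move=> root_r.
have avoid x : (forall k, iter k parent x <> z) -> path e x p -> z \notin p ->
    forall k, iter k parent (last x p) <> z.
  elim: p x => //= y p IHp x anc_x /andP[exy yp].
  rewrite inE negb_or => /andP[zy zp]; apply: IHp => // k.
  case: (edge_parent exy) => [] [def _]; subst.
    by rewrite -iterSr; apply: anc_x.
  by case: k => [|k]; [apply/eqP; rewrite eq_sym | rewrite iterSr; apply: anc_x].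
move=> rp; rewrite inE negb_or => /andP[zr zp].
apply: (avoid r _ rp zp 1) => k.
have -> : iter k parent r = r by elim: k => //= k ->.
by apply/eqP; rewrite eq_sym.
Qed.

End RootedTree.

Lemma path_through_root (X : eqType) (e : rel X) (V : seq X) r : symmetric e ->
  (forall x, x \in V -> exists2 p, path e x p & last x p = r) ->
  forall x y, x \in V -> y \in V -> exists2 p, path e x p & last x p = y.
Proof.
move=> e_sym to_root x y /to_root[p xp px] /to_root[q yq qy].
exists (p ++ rev (belast y q)); rewrite ?cat_path ?last_cat px -qy.
  by rewrite xp rev_path; apply: sub_path yq => ? ?; rewrite e_sym.
by case: q {yq qy} => //= z q; rewrite rev_cons last_rcons.
Qed.

(** * ABoxes *)

Lemma ind_concept (A : abox) B a : CAss B a \in A -> a \in ind A.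
Proof. by move=> Ba; apply/flatten_mapP; exists (CAss B a); rewrite ?mem_head. Qed.

Lemma ind_role (A : abox) R a b : RAss R a b \in A -> a \in ind A /\ b \in ind A.
Proof.
by move=> Rab; split; apply/flatten_mapP; exists (RAss R a b); rewrite // !inE eqxx ?orbT.
Qed.

Lemma adjP (A : abox) x y :
  reflect (exists R, RAss R x y \in A \/ RAss R y x \in A) (adj A x y).
Proof.
apply: (iffP hasP) => [[[//|R c d] Rcd]|[R [] xyA]].
- by case/orP=> /andP[/eqP<- /eqP<-]; exists R; [left | right].
- by exists (RAss R x y); rewrite // !eqxx.
- by exists (RAss R y x); rewrite // !eqxx orbT.
Qed.

Lemma adj_sym (A : abox) : symmetric (adj A).
Proof.
by move=> x y; apply/adjP/adjP => -[R []]; exists R; [right | left | right | left].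
Qed.

Lemma ind_inv (A : abox) b : b \in ind A ->
  (exists B, CAss B b \in A) \/ (exists c, adj A b c).
Proof.
case/flatten_mapP=> -[B a|R a c] xA; rewrite !inE; first by move/eqP->; left; exists B.
by case/orP=> /eqP->; right; eexists; apply/adjP; exists R; [left | right]; apply: xA.
Qed.

Definition abox_hom (g : iname -> iname) (A' A : abox) : Prop :=
  (forall B a, CAss B a \in A' -> CAss B (g a) \in A) /\
  (forall R a b, RAss R a b \in A' -> RAss R (g a) (g b) \in A).

Lemma abox_hom_sig g A' A S : abox_hom g A' A -> sig_abox S A -> sig_abox S A'.
Proof. by move=> [gC gR] [sC sR]; split=> [B a /gC/sC|R a b /gR/sR]. Qed.

(** * The chase *)

Fixpoint elt_root (t : elt) : iname :=
  match t with Ind a => a | Succ u _ _ => elt_root u end.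

Section Chase.
Variables (T : tbox) (A : abox).
Notation N := (normal_form T).

Lemma cfact_mono m n C t : m <= n -> cfact (chase T A m) C t -> cfact (chase T A n) C t.
Proof.
by move/subnK <- => Ct; elim: (n - m) => // k IHk; rewrite addSn; apply: sc_old.
Qed.

Lemma rfact_mono m n R t u :
  m <= n -> rfact (chase T A m) R t u -> rfact (chase T A n) R t u.
Proof.
by move/subnK <- => tu; elim: (n - m) => // k IHk; rewrite addSn; apply: sr_old.
Qed.

Lemma chase_fact_dom n :
  (forall C t, cfact (chase T A n) C t -> cdom (chase T A n) t) /\
  (forall R t u, rfact (chase T A n) R t u ->
     cdom (chase T A n) t /\ cdom (chase T A n) u).
Proof.
elim: n => [|n [IHc IHr]].
  by split=> [_ _ [B [a [_ -> _]]]|_ _ _ [a [b [-> -> _]]]]; [exists a | split; eexists].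
split=> [C t step|R t u step].
  case: step => {C t} [C t|C D t _|C D E t _|R C D t u _|C t _|C R D t u _ _|t R B].
  - by move/IHc; apply: sd_old.
  - by move/IHc; apply: sd_old.
  - by move/IHc=> ? _; apply: sd_old.
  - by case/IHr=> ? _ _; apply: sd_old.
  - exact: sd_old.
  - by case/IHr=> _ ?; apply: sd_old.
  - exact: sd_new.
case: step => {R t u} [R t u /IHr[td ud]|t R B nS]; first by split; apply: sd_old.
by split; [apply: sd_old; case: nS => -[C _ /IHc] | apply: sd_new].
Qed.

Lemma cfact_dom n C t : cfact (chase T A n) C t -> cdom (chase T A n) t.
Proof. by have [+ _] := chase_fact_dom n; apply. Qed.

Lemma rfact_dom n R t u : rfact (chase T A n) R t u ->
  cdom (chase T A n) t /\ cdom (chase T A n) u.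
Proof. by have [_] := chase_fact_dom n; apply. Qed.

Lemma rfact_inv n R t u : rfact (chase T A n) R t u ->
  (exists a b, [/\ t = Ind a, u = Ind b & RAss R a b \in A]) \/
  (exists B m, [/\ m < n, u = Succ t R B & needs_succ N (chase T A m) t R B]).
Proof.
elim: n R t u => [|n IHn] R t u /=; first by left.
case=> [R' t' u' /IHn[|[B [m [mn -> nS]]]]|t' R' B nS]; first by left.
- by right; exists B, m; split=> //; apply: ltnW.
- by right; exists B, n.
Qed.

Lemma cdom_succ n t R B : cdom (chase T A n) (Succ t R B) ->
  exists2 m, m < n & needs_succ N (chase T A m) t R B.
Proof.
elim: n => [[]|n IHn] //= step.
case E : _ / step => [u ud|u R' B' nS]; last by case: E nS => -> -> ->; exists n.
by subst u; have [m mn] := IHn ud; exists m => //; apply: ltnW.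
Qed.

Lemma cdom_rfact n t R B :
  cdom (chase T A n) (Succ t R B) -> rfact (chase T A n) R t (Succ t R B).
Proof. by case/cdom_succ=> m mn nS; apply: (rfact_mono mn); apply: sr_new. Qed.

Lemma cdom_parent n t R B : cdom (chase T A n) (Succ t R B) -> cdom (chase T A n) t.
Proof. by move/cdom_rfact/rfact_dom=> []. Qed.

End Chase.

(** * Normal forms *)

Definition is_all (C : concept) : bool :=
  if C is Neg (Ex _ (Neg _)) then true else false.

Lemma norm_pos_Neg D : ~~ is_all (Neg D) ->
  norm_pos (Neg D) = [:: NAnd (Neg D) D Bot, NBot Bot & norm_neg D].
Proof. by case: D => //= R []. Qed.

Lemma occurrences_Neg p D : ~~ is_all (Neg D) ->
  occurrences p (Neg D) = (p, Neg D) :: occurrences (~~ p) D.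
Proof. by case: D => //= R []. Qed.

Lemma positive_concept_ind (P : concept -> Prop) :
  P Top -> (forall B, P (Name B)) ->
  (forall R D, P D -> P (All R D)) ->
  (forall D, ~~ is_all (Neg D) -> P (Neg D)) ->
  (forall D E, P D -> P E -> P (And D E)) ->
  (forall R D, P D -> P (Ex R D)) ->
  forall C, P C.
Proof.
move=> PTop PName PAll PNeg PAnd PEx; fix IH 1; case=> [|B|D|D E|R D].
- exact: PTop.
- exact: PName.
- case: D => [|B|D|D E|R [|B|D|D E|S D]]; try exact: PNeg.
  exact/PAll/IH.
- by apply: PAnd; apply: IH.
- exact/PEx/IH.
Qed.

(* X interprets the names of the normal form: X C is the extension of the name
   indexed by C. *)
Definition nci_holds (I : interp) (X : concept -> dom I -> Prop) (x : nci) : Prop :=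
  match x with
  | NSub B C => forall d, X B d -> X C d
  | NAnd B1 B2 C => forall d, X B1 d -> X B2 d -> X C d
  | NExL R B C => forall d e, rint R d e -> X B e -> X C d
  | NBot B => forall d, ~ X B d
  | NTop B => forall d, X B d
  | NExR B R C => forall d, X B d -> exists2 e, rint R d e & X C e
  | NAll B R C => forall d e, X B d -> rint R d e -> X C e
  end.

Lemma norm_neg_holds (I : interp) C :
  {in norm_neg C, forall x, nci_holds (@cext I) x}.
Proof.
elim: C => [||D _|D IHD E IHE|R D IHD] x //=.
- by rewrite inE => /eqP->.
- by rewrite inE mem_cat => /or3P[/eqP->|/IHD|/IHE].
- by rewrite inE => /orP[/eqP-> d e de De|/IHD //]; exists e.
Qed.

Lemma norm_pos_holds (I : interp) C :
  {in norm_pos C, forall x, nci_holds (@cext I) x}.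
Proof.
elim/positive_concept_ind: C => [||R D IHD|D nall|D E IHD IHE|R D IHD] x //.
- rewrite inE => /orP[/eqP-> d e nDd de|/IHD //].
  by apply: contrapT => nDe; apply: nDd; exists e.
- rewrite norm_pos_Neg // !inE => /or3P[/eqP-> d nDd /nDd //|/eqP-> d|].
    by apply.
  exact: norm_neg_holds.
- by rewrite /= !inE mem_cat => /or4P[/eqP-> d []|/eqP-> d []|/IHD|/IHE].
- by rewrite inE => /orP[/eqP->|/IHD].
Qed.

Lemma mem_normal_form (T : tbox) x : reflect
  (exists2 ci, ci \in T & x \in NSub ci.1 ci.2 :: norm_neg ci.1 ++ norm_pos ci.2)
  (x \in normal_form T).
Proof. exact: flatten_mapP. Qed.

Lemma normal_form_holds (I : interp) (T : tbox) : sat_tbox I T ->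
  {in normal_form T, forall x, nci_holds (@cext I) x}.
Proof.
move=> IT x /mem_normal_form[[C D] CD].
rewrite inE mem_cat => /or3P[/eqP-> d|/norm_neg_holds //|/norm_pos_holds //].
exact: IT CD d.
Qed.

Definition is_neg (C : concept) : bool := if C is Neg _ then true else false.

Definition horn_concept (p : bool) (C : concept) : bool :=
  all (fun o => o.1 || ~~ is_neg o.2) (occurrences p C).

Section NormalFormConverse.
Variables (I : interp) (X : concept -> dom I -> Prop).
Hypothesis X_Name : forall B d, X (Name B) d <-> cint B d.

Lemma norm_neg_sub C d : horn_concept false C ->
  {in norm_neg C, forall x, nci_holds X x} -> cext C d -> X C d.
Proof.
rewrite /horn_concept; elim: C d => [|B|D _|D IHD E IHE|R D IHD] d //=.
- by move=> _ /forall_cons[XTop _] _; apply: XTop.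
- by move=> _ _ Bd; apply/X_Name.
- rewrite all_cat => /andP[hD hE] /forall_cons[XDE sub] [Dd Ed]; apply: XDE.
    by apply: IHD Dd => // x xD; apply: sub; rewrite mem_cat xD.
  by apply: IHE Ed => // x xE; apply: sub; rewrite mem_cat xE orbT.
- by move=> hD /forall_cons[XRD sub] [e de De]; apply: XRD de _; apply: IHD.
Qed.

Lemma norm_pos_sup C d : horn_concept true C ->
  {in norm_pos C, forall x, nci_holds X x} -> X C d -> cext C d.
Proof.
elim/positive_concept_ind: C d => [|B|R D IHD|D nall|D E IHD IHE|R D IHD] d.
- by [].
- by move=> _ _ /X_Name.
- move=> hD /forall_cons[XD sub] XDd [e de]; apply; apply: IHD => //.
  exact: XD XDd de.
- rewrite /horn_concept norm_pos_Neg // occurrences_Neg // => hD.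
  move=> /forall_cons[XD /forall_cons[XBot sub]] XDd Dd; apply: (XBot d).
  by apply: XD XDd _; apply: norm_neg_sub.
- rewrite /horn_concept /= all_cat => /andP[hD hE].
  move=> /forall_cons[XD /forall_cons[XE sub]] XDE; split.
    by apply: IHD => // [x xD|]; [apply: sub; rewrite mem_cat xD | apply: XD].
  by apply: IHE => // [x xE|]; [apply: sub; rewrite mem_cat xE orbT | apply: XE].
- move=> hD /forall_cons[XD sub] /XD[e de XDe]; exists e => //.
  exact: IHD hD sub XDe.
Qed.

Lemma sat_tbox_normal_form T : horn T ->
  {in normal_form T, forall x, nci_holds X x} -> sat_tbox I T.
Proof.
move=> [hornT _] XN C D CD d Cd.
have /allP horn_CD : forall o, o \in occurrences false C ++ occurrences true D ->
    o.1 || ~~ is_neg o.2.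
  by move=> [[] [||E||]] //= occE; case: (hornT E); exists (C, D).
have [hC hD] : horn_concept false C /\ horn_concept true D.
  by apply/andP; rewrite -all_cat.
have sub x : x \in NSub C D :: norm_neg C ++ norm_pos D -> nci_holds X x.
  by move=> xCD; apply: XN; apply/mem_normal_form; exists (C, D).
move/forall_cons: sub => [XCD sub].
apply: norm_pos_sup => // [x xD|]; first by apply: sub; rewrite mem_cat xD orbT.
by apply: XCD; apply: norm_neg_sub => // x xC; apply: sub; rewrite mem_cat xC.
Qed.

End NormalFormConverse.

(** * Mapping chase trees into models *)

Definition orient (fwd : bool) (X Y : Type) (r : X -> X -> Y) (x y : X) : Y :=
  if fwd then r x y else r y x.

(* The direction and the role of the edge that a rule looks along, seen from the
   element whose label it extends, and the label that it requires at the other end. *)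
Definition edge_premise (x : nci) : option (bool * rname * concept) :=
  match x with
  | NExL R D _ => Some (true, R, D)
  | NAll C R _ => Some (false, R, C)
  | _ => None
  end.

Definition edge_premises (T : tbox) : seq (bool * rname * concept) :=
  pmap edge_premise (normal_form T).

Section Simulation.
Variables (T : tbox) (A : abox) (J : interp).

(* Junk value d when d has no R-successor in B. *)
Definition succ_choice (d : dom J) (R : rname) (B : concept) : dom J :=
  if pselect (exists2 e, rint R d e & cext B e) is left ex
  then projT1 (cid2 ex) else d.

Lemma succ_choiceP d R B : (exists2 e, rint R d e & cext B e) ->
  rint R d (succ_choice d R B) /\ cext B (succ_choice d R B).
Proof. by rewrite /succ_choice => ex; case: pselect => // ex'; case: cid2. Qed.

Fixpoint tree_map (x : dom J) (t : elt) : dom J :=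
  match t with Ind _ => x | Succ u R B => succ_choice (tree_map x u) R B end.

(* P n a x says that x simulates the individual a for n rounds of the chase. *)
Record simulation (P : nat -> iname -> dom J -> Prop) : Prop := Simulation {
  sim_pred : forall n a x, P n.+1 a x -> P n a x;
  sim_concept : forall n a x B, P n a x -> CAss B a \in A -> cint B x;
  sim_edge : forall n a x fwd R D c,
    P n.+1 a x -> (fwd, R, D) \in edge_premises T ->
    orient fwd (RAss R) a c \in A -> cfact (chase T A n) D (Ind c) ->
    exists c' y, [/\ P n c' y, orient fwd (rint R) x y & cfact (chase T A n) D (Ind c')]
}.

Lemma model_simulation : sat_abox J A -> simulation (fun _ a x => x = indiv J a).
Proof.
move=> [JC JR]; split=> // [_ a _ B -> /JC //|n a _ fwd R D c -> _ ac Dc].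
by exists c, (indiv J c); split=> //; case: fwd ac => /JR.
Qed.

Variable P : nat -> iname -> dom J -> Prop.
Hypotheses (JT : sat_tbox J T) (P_sim : simulation P).

Lemma sim_le m n a x : m <= n -> P n a x -> P m a x.
Proof.
by move/subnK <-; elim: (n - m) => // k IHk; rewrite addSn => /(sim_pred P_sim)/IHk.
Qed.

Definition sound_at (n : nat) : Prop := forall t x C,
  P n (elt_root t) x -> cfact (chase T A n) C t -> cext C (tree_map x t).

Lemma sound_at_succ n u x R B :
  sound_at n -> P n (elt_root u) x -> needs_succ (normal_form T) (chase T A n) u R B ->
  rint R (tree_map x u) (tree_map x (Succ u R B)) /\ cext B (tree_map x (Succ u R B)).
Proof.
move=> sound Px [[C CRB Cu] _]; apply: succ_choiceP.
exact: (normal_form_holds JT CRB) (sound _ _ _ Px Cu).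
Qed.

Lemma sound_at_edge n fwd R D t u x :
  (forall m, m <= n -> sound_at m) ->
  P n.+1 (elt_root t) x -> (fwd, R, D) \in edge_premises T ->
  orient fwd (rfact (chase T A n) R) t u -> cfact (chase T A n) D u ->
  exists2 y, orient fwd (rint R) (tree_map x t) y & cext D y.
Proof.
move=> sound Px FRD tu Du.
have sound_succ v B m : m < n -> needs_succ (normal_form T) (chase T A m) v R B ->
    elt_root v = elt_root t -> rint R (tree_map x v) (tree_map x (Succ v R B)).
  move=> mn nS vt; apply: (sound_at_succ (sound m (ltnW mn)) _ nS).1.
  by rewrite vt; apply: sim_le Px; apply: leqW; apply: ltnW.
have sound_same : elt_root u = elt_root t -> cext D (tree_map x u).
  by move=> ut; apply: sound Du => //; rewrite ut; apply: sim_pred.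
case: fwd FRD tu => FRD /rfact_inv[[a [c [ta ? ac]]]|[B [m [mn ? nS]]]]; subst.
- have [c' [y [Py xy Dc']]] := sim_edge P_sim Px FRD ac Du.
  by exists y => //; apply: (sound n (leqnn n) (Ind c')).
- by exists (tree_map x (Succ t R B)); [apply: sound_succ mn nS _ | apply: sound_same].
- have [c' [y [Py yx Dc']]] := sim_edge P_sim Px FRD ac Du.
  by exists y => //; apply: (sound n (leqnn n) (Ind c')).
- by exists (tree_map x u); [apply: sound_succ mn nS _ | apply: sound_same].
Qed.

Lemma edge_premises_NExL R D C : NExL R D C \in normal_form T ->
  (true, R, D) \in edge_premises T.
Proof. by move=> RDC; rewrite mem_pmap; apply/mapP; exists (NExL R D C). Qed.

Lemma edge_premises_NAll R D C : NAll D R C \in normal_form T ->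
  (false, R, D) \in edge_premises T.
Proof. by move=> RDC; rewrite mem_pmap; apply/mapP; exists (NAll D R C). Qed.

Lemma tree_map_concept n : sound_at n.
Proof.
elim/ltn_ind: n => -[_ t x _ Px [B [a [-> ta Ba]]]|n IHn t x C Px step].
  by subst t; apply: (sim_concept P_sim Px Ba).
have sound : sound_at n by apply: IHn.
have holds := normal_form_holds JT.
case: step Px (sim_pred P_sim Px) => {C t}
  [C t|C D t CD|C D E t CDE|R C D t u RDC|C t topC|C R D t u CRD|t R B nS].
- by move=> Ct _ Px; apply: sound Ct.
- by move=> Ct _ Px; apply: (holds _ CD); apply: sound Ct.
- by move=> Ct Dt _ Px; apply: (holds _ CDE); [apply: sound Ct | apply: sound Dt].
- move=> tu Cu Px _.
  have [y ty Cy] := @sound_at_edge n true R C t u x IHn Px (edge_premises_NExL RDC) tu Cu.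
  exact: (holds _ RDC) ty Cy.
- by move=> _ _ _; apply: (holds _ topC).
- move=> Ct tu Px _.
  have [y yu Cy] := @sound_at_edge n false R C u t x IHn Px (edge_premises_NAll CRD) tu Ct.
  exact: (holds _ CRD) Cy yu.
- by move=> _ Px; apply: (@sound_at_succ n t x R B sound Px nS).2.
Qed.

Lemma tree_map_role n R t B x :
  P n (elt_root t) x -> rfact (chase T A n) R t (Succ t R B) ->
  rint R (tree_map x t) (tree_map x (Succ t R B)).
Proof.
move=> Px /rfact_inv[[a [b []]] //|[_ [m [mn [<-] nS]]]].
by apply: (sound_at_succ (@tree_map_concept m) _ nS).1; apply: sim_le Px; apply: ltnW.
Qed.

End Simulation.

Definition chase_map (J : interp) (t : elt) : dom J :=
  tree_map (indiv J (elt_root t)) t.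

Lemma chase_map_concept (T : tbox) (A : abox) (J : interp) n C t :
  model T A J -> cfact (chase T A n) C t -> cext C (chase_map J t).
Proof. by move=> [JT /(model_simulation T) P_sim]; apply: (tree_map_concept JT P_sim). Qed.

Lemma chase_map_role (T : tbox) (A : abox) (J : interp) n R t u :
  model T A J -> rfact (chase T A n) R t u -> rint R (chase_map J t) (chase_map J u).
Proof.
move=> [JT JA] tu; have P_sim := model_simulation T JA.
have [[a [b [-> -> Rab]]]|[B [m [_ uB _]]]] := rfact_inv tu.
  by have [_] := JA; apply.
by subst u; apply: (tree_map_role JT P_sim _ tu).
Qed.

(** * The canonical model *)

Definition chase_limit (T : tbox) (A : abox) : cstate := CState
  (fun t => exists n, cdom (chase T A n) t)
  (fun C t => exists n, cfact (chase T A n) C t)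
  (fun R t u => exists n, rfact (chase T A n) R t u).

Section CanonicalModel.
Variables (T : tbox) (A : abox).
Notation N := (normal_form T).
Notation I := (canonical_model T A).
Notation Ch := (chase_limit T A).

Lemma chase_elt_onto t : cdom Ch t -> exists e : dom I, chase_elt e = t.
Proof.
case: t => [b|u R B] tdom; first by exists (inl b).
by exists (inr (exist _ (Succ u R B) (conj isT tdom))).
Qed.

Lemma chase_elt_dom (d : dom I) : cdom Ch (chase_elt d).
Proof. by case: d => [a|[t []]] //; exists 0, a. Qed.

Lemma chase_limit_ex_succ B R C t : NExR B R C \in N -> cfact Ch B t ->
  exists2 u, rfact Ch R t u & cfact Ch C u.
Proof.
move=> BRC [n Bt].
case: (pselect (exists2 u, rfact (chase T A n) R t u & cfact (chase T A n) C u)).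
  by case=> u tu Cu; exists u; exists n.
move=> none; have nS : needs_succ N (chase T A n) t R C by split=> //; exists B.
by exists (Succ t R C); exists n.+1; [apply: sr_new | apply: sc_new].
Qed.

Lemma chase_limit_holds : consistent T A ->
  {in N, forall x, nci_holds (fun C (d : dom I) => cfact Ch C (chase_elt d)) x}.
Proof.
move=> [J JTA] [B C|B C D|R B C|B|B|B R C|B R C] xN d /=.
- by case=> n Bd; exists n.+1; apply: sc_sub xN Bd.
- case=> m Bd [n Cd]; exists (maxn m n).+1; apply: (sc_and xN).
    exact: cfact_mono (leq_maxl _ _) Bd.
  exact: cfact_mono (leq_maxr _ _) Cd.
- move=> e [m de] [n Be]; exists (maxn m n).+1; apply: (sc_exl xN).
    exact: rfact_mono (leq_maxl _ _) de.
  exact: cfact_mono (leq_maxr _ _) Be.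
- case=> n /(chase_map_concept JTA) Bd.
  by have [/normal_form_holds/(_ _ xN) noB _] := JTA; apply: noB Bd.
- by have [n dn] := chase_elt_dom d; exists n.+1; apply: sc_top xN dn.
- case/(chase_limit_ex_succ xN) => u [n du] Cu.
  have udom : cdom Ch u by exists n; apply: (rfact_dom du).2.
  by have [e eu] := chase_elt_onto udom; exists e; rewrite /= eu //; exists n.
- move=> e [m Bd] [n de]; exists (maxn m n).+1.
  apply: (sc_all xN (t := chase_elt d)).
    exact: cfact_mono (leq_maxl _ _) Bd.
  exact: rfact_mono (leq_maxr _ _) de.
Qed.

Lemma canonical_model_is_model : horn T -> consistent T A -> model T A I.
Proof.
move=> hornT cons; split.
  by apply: sat_tbox_normal_form hornT (chase_limit_holds cons) => B d.
by split=> [B a Ba|R a b Rab]; exists 0; [exists B, a | exists a, b].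
Qed.

End CanonicalModel.

(** * Homomorphisms from the connected part of the chase *)

Fixpoint con_elt (S : signature) (A : abox) (t : elt) : Prop :=
  match t with
  | Ind a => a \in ind A
  | Succ u R _ => con_elt S A u /\ sigR S R
  end.

Definition con_tree (S : signature) (A : abox) (b : iname) (t : elt) : Prop :=
  con_elt S A t /\ elt_root t = b.

Lemma con_elt_root S A t : con_elt S A t -> elt_root t \in ind A.
Proof. by elim: t => //= u IHu R B [/IHu]. Qed.

Lemma con_elt_rfact S T A n R t u : sigR S R -> rfact (chase T A n) R t u ->
  con_elt S A t <-> con_elt S A u.
Proof.
move=> SR /rfact_inv[[a [b [-> -> /ind_role[aA bA]]]]|[B [m [_ -> _]]]].
  by split.
by split=> [|[]].
Qed.

Lemma con_dom_con_elt S T A (d : dom (canonical_model T A)) :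
  con_dom S A d -> con_elt S A (chase_elt d).
Proof. by elim=> // R e f _ ce SR [n /(con_elt_rfact SR) <-]. Qed.

Definition chase_hom (S : signature) (s : cstate) (P : elt -> Prop) (I : interp)
    (h : elt -> dom I) : Prop :=
  [/\ forall a, P (Ind a) -> h (Ind a) = indiv I a,
      forall B t, sigC S B -> P t -> cfact s (Name B) t -> cint B (h t)
    & forall R t u, sigR S R -> P t -> P u -> rfact s R t u -> rint R (h t) (h u)].

Lemma con_hom_embeddable_chase_hom S T A I (h : elt -> dom I) :
  chase_hom S (chase_limit T A) (con_elt S A) h ->
  con_hom_embeddable S A (canonical_model T A) I.
Proof.
move=> [hI hC hR]; exists (fun d => h (chase_elt d)).
split=> [B d SB /con_dom_con_elt|R d e SR /con_dom_con_elt + /con_dom_con_elt|a aA _].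
- exact: hC.
- exact: hR.
- exact: hI.
Qed.

Lemma chase_map_chase_hom S T A n P (J : interp) :
  model T A J -> chase_hom S (chase T A n) P (chase_map J).
Proof.
move=> JTA; split=> // [B t _ _|R t u _ _ _]; last exact: chase_map_role JTA.
exact: (chase_map_concept JTA (C := Name B)).
Qed.

Lemma chase_hom_glue S T A n (I : interp) : sat_abox I A ->
  (forall b, b \in ind A -> exists h : elt -> dom I,
     chase_hom S (chase T A n) (con_tree S A b) h) ->
  exists h : elt -> dom I, chase_hom S (chase T A n) (con_elt S A) h.
Proof.
move=> [_ IR] tree_homs.
have hom_at b : exists h : elt -> dom I, b \in ind A ->
    chase_hom S (chase T A n) (con_tree S A b) h.
  case: (boolP (b \in ind A)) => [/tree_homs[h]|_]; first by exists h.
  by exists (fun _ => indiv I b).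
have [h hP] := choice hom_at; exists (fun t => h (elt_root t) t).
have hI a : a \in ind A -> h a (Ind a) = indiv I a by move=> /[dup] aA /hP[+ _ _]; apply.
split=> [a aA|B t SB ct Bt|R t u SR ct cu tu]; first exact: hI.
  by have [_ hC _] := hP _ (con_elt_root ct); apply: hC.
have [[a [b [ta ub Rab]]]|[B [m [_ uB _]]]] := rfact_inv tu; subst.
  by rewrite /= !hI //; apply: IR.
by have [_ _ hR] := hP _ (con_elt_root ct); apply: hR.
Qed.

(** * Matching rooted queries in the chase *)

Definition cq_vars (q : cq) : seq var := flatten (map atom_vars (atoms q)).

Lemma cq_vars_concept q B x : CAtom B x \in atoms q -> x \in cq_vars q.
Proof. by move=> Bx; apply/flatten_mapP; exists (CAtom B x); rewrite // mem_head. Qed.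

Lemma cq_vars_role q R x y : RAtom R x y \in atoms q ->
  x \in cq_vars q /\ y \in cq_vars q.
Proof.
by move=> Rxy; split; apply/flatten_mapP; exists (RAtom R x y); rewrite // !inE eqxx ?orbT.
Qed.

Lemma eq_map_exists (X Y : eqType) Z (f : X -> Z) (g : Y -> Z) s t x :
  map f s = map g t -> x \in s -> exists2 y, y \in t & f x = g y.
Proof.
elim: s t => [|x' s IHs] [|y t] //= [fy /IHs{}IHs].
rewrite inE => /predU1P[->|/IHs[z zt ->]]; first by exists y; rewrite ?mem_head.
by exists z; rewrite // inE zt orbT.
Qed.

Lemma rooted_match_con_elt S T A q a (v : var -> dom (canonical_model T A)) :
  rooted q -> sig_cq S q -> {subset a <= ind A} ->
  map v (answer q) = map (indiv _) a ->
  (forall R x y, RAtom R x y \in atoms q -> rint R (v x) (v y)) ->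
  forall x, x \in cq_vars q -> con_elt S A (chase_elt (v x)).
Proof.
move=> rooted_q [_ qR] aA va vR.
have con_answer x : x \in answer q -> con_elt S A (chase_elt (v x)).
  by case/(eq_map_exists va) => b /aA bA ->.
move=> x xq; case: (boolP (x \in answer q)) => [/con_answer //|xna].
have [|y ya] := rooted_q x; first by apply/andP.
elim=> [|R z w _ cz zw|R z w _ cz wz]; first exact: con_answer.
  by have [n /(con_elt_rfact (qR _ _ _ zw)) <-] := vR _ _ _ zw.
by have [n /(con_elt_rfact (qR _ _ _ wz)) ->] := vR _ _ _ wz.
Qed.

Lemma sat_cq_canonical_stage S T A q a :
  rooted q -> sig_cq S q -> {subset a <= ind A} ->
  sat_cq (canonical_model T A) q a ->
  exists n, forall (I : interp) (h : elt -> dom I),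
    chase_hom S (chase T A n) (con_elt S A) h -> sat_cq I q a.
Proof.
move=> rooted_q sig_q aA [v va [vC vR]]; pose e x := chase_elt (v x).
have con x : x \in cq_vars q -> con_elt S A (e x) by apply: rooted_match_con_elt va vR x.
pose holds n t := match t with
  | CAtom B x => cfact (chase T A n) (Name B) (e x)
  | RAtom R x y => rfact (chase T A n) R (e x) (e y) end.
have [n holds_n] : exists n, forall t, t \in atoms q -> holds n t.
  apply: common_stage => [m n [B x|R x y] mn|[B x|R x y]].
  - exact: cfact_mono.
  - exact: rfact_mono.
  - exact: vC.
  - exact: vR.
have [qC qR] := sig_q; exists n => I h [hI hC hR]; exists (fun x => h (e x)); last split.
- rewrite (map_comp (fun d => h (chase_elt d)) v) va -map_comp.
  by apply/eq_in_map => b /aA; apply: hI.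
- by move=> B x Bx; apply: hC (qC _ _ Bx) (con _ (cq_vars_concept Bx)) (holds_n _ Bx).
- move=> R x y Rxy; have [xq yq] := cq_vars_role Rxy.
  by apply: hR (qR _ _ _ Rxy) (con _ xq) (con _ yq) (holds_n _ Rxy).
Qed.

(** * Numbering the elements of the chase *)

Fixpoint concept_code (C : concept) : nat :=
  match C with
  | Top => CodeSeq.code [:: 0]
  | Name B => CodeSeq.code [:: 1; B]
  | Neg D => CodeSeq.code [:: 2; concept_code D]
  | And D E => CodeSeq.code [:: 3; concept_code D; concept_code E]
  | Ex R D => CodeSeq.code [:: 4; R; concept_code D]
  end.

Lemma concept_code_inj : injective concept_code.
Proof.
elim=> [|B|D IHD|D IHD E IHE|R D IHD] [|B'|D'|D' E'|R' D']
  => /(can_inj CodeSeq.codeK) // [].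
- by move->.
- by move/IHD->.
- by move=> /IHD-> /IHE->.
- by move=> -> /IHD->.
Qed.

Fixpoint elt_code (t : elt) : nat :=
  match t with
  | Ind a => CodeSeq.code [:: 0; a]
  | Succ u R B => CodeSeq.code [:: 1; elt_code u; R; concept_code B]
  end.

Lemma elt_code_inj : injective elt_code.
Proof.
elim=> [a|u IHu R B] [a'|u' R' B'] /(can_inj CodeSeq.codeK) // [].
  by move->.
by move=> /IHu-> -> /concept_code_inj->.
Qed.

Lemma elt_code_lt_Succ u R B : elt_code u < elt_code (Succ u R B).
Proof. by have /and5P[] := CodeSeq.ltn_code [:: 1; elt_code u; R; concept_code B]. Qed.

Lemma role_lt_elt_code u R B : R < elt_code (Succ u R B).
Proof. by have /and5P[] := CodeSeq.ltn_code [:: 1; elt_code u; R; concept_code B]. Qed.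

(** * Conjunctive queries describing finite parts of the chase *)

Section ChaseQuery.
Variables (S : signature) (T : tbox) (A : abox).

Inductive chase_atom : atom -> Prop :=
| ChaseConcept n B t : sigC S B -> con_elt S A t ->
    cfact (chase T A n) (Name B) t -> chase_atom (CAtom B (elt_code t))
| ChaseRole n R t u : sigR S R -> con_elt S A t ->
    rfact (chase T A n) R t u -> chase_atom (RAtom R (elt_code t) (elt_code u)).

Definition atom_numbers (t : atom) : seq nat :=
  match t with CAtom B x => [:: B; x] | RAtom R x y => [:: R; x; y] end.

Definition bounded_atoms (m : nat) : seq atom :=
  [seq CAtom B x | B <- iota 0 m, x <- iota 0 m] ++
  [seq RAtom Rx.1 Rx.2 y | Rx <- [seq (R, x) | R <- iota 0 m, x <- iota 0 m],
                           y <- iota 0 m].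

Lemma mem_bounded_atoms m t : (t \in bounded_atoms m) = all (gtn m) (atom_numbers t).
Proof.
have iotam i : (i \in iota 0 m) = (i < m) by rewrite mem_iota.
rewrite mem_cat; apply/idP/idP.
  case/orP=> /allpairsP[[x y] /= [+ + ->]] /=; first by rewrite !iotam => -> ->.
  by case/allpairsP=> -[R z] /= [+ + ->]; rewrite !iotam => /= -> -> ->.
case: t => [B x|R x y] /=; rewrite andbT; last first.
  move=> /and3P[Rm xm ym]; apply/orP; right; apply/allpairsP; exists ((R, x), y).
  by split; rewrite ?iotam //; apply: allpairs_f; rewrite iotam.
by case/andP=> Bm xm; apply/orP; left; apply: allpairs_f; rewrite iotam.
Qed.

(* Numbers increase along the chase trees, so bounding them leaves the query rooted. *)
Definition chase_query (m : nat) : cq := CQ [seq elt_code (Ind a) | a <- ind A]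
  [seq t <- bounded_atoms m | `[< chase_atom t >]].

Lemma chase_queryP m t : t \in atoms (chase_query m) <->
  chase_atom t /\ all (gtn m) (atom_numbers t).
Proof.
rewrite mem_filter mem_bounded_atoms; split; first by case/andP=> /asboolP.
by case=> /asboolP -> ->.
Qed.

Lemma chase_query_sig m : sig_cq S (chase_query m).
Proof.
have sig t : chase_atom t -> match t with
    | CAtom B _ => sigC S B
    | RAtom R _ _ => sigR S R end by case.
by split=> [B x|R x y] /chase_queryP[/sig].
Qed.

Lemma con_elt_parent_atom m n u R B :
  con_elt S A (Succ u R B) -> cdom (chase T A n) (Succ u R B) ->
  elt_code (Succ u R B) < m ->
  RAtom R (elt_code u) (elt_code (Succ u R B)) \in atoms (chase_query m).
Proof.
move=> [cu SR] /cdom_rfact uR tm; apply/chase_queryP; split.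
  exact: ChaseRole SR cu uR.
apply/and4P; split=> //; apply: ltn_trans tm.
  exact: role_lt_elt_code.
exact: elt_code_lt_Succ.
Qed.

Lemma chase_query_var m x : x \in cq_vars (chase_query m) ->
  exists t n, [/\ con_elt S A t, cdom (chase T A n) t, elt_code t = x & x < m].
Proof.
case/flatten_mapP=> t /chase_queryP[[n B u _ cu Bu|n R u w SR cu uw] /=].
  rewrite inE => /and3P[_ um _] /eqP->; exists u, n; split=> //.
  exact: cfact_dom Bu.
have [udom wdom] := rfact_dom uw.
rewrite !inE => /and4P[_ um wm _] /orP[] /eqP->; first by exists u, n.
by exists w, n; split=> //; apply/(con_elt_rfact SR uw).
Qed.

Lemma chase_query_rooted m : rooted (chase_query m).
Proof.
move=> x /andP[/chase_query_var[t [n [+ + <- +]]] _].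
elim: t => [a|u IHu R B] ct tdom tm.
  by exists (elt_code (Ind a)); [apply: map_f | apply: qconn_refl].
have um := ltn_trans (elt_code_lt_Succ u R B) tm.
have [y ya yu] := IHu ct.1 (cdom_parent tdom) um.
by exists y => //; apply: qconn_fwd yu (con_elt_parent_atom ct tdom tm).
Qed.

Lemma chase_query_entailed m : entails_cq T A (chase_query m) (ind A).
Proof.
move=> J JTA; have [decode decodeK] := injective_cancel (Ind 0) elt_code_inj.
pose v i := chase_map J (decode i).
have sat t : chase_atom t -> match t with
    | CAtom B x => cint B (v x)
    | RAtom R x y => rint R (v x) (v y) end.
  case=> [n B u _ _ Bu|n R u w _ _ uw]; rewrite /v !decodeK.
    exact: (chase_map_concept JTA Bu).
  exact: chase_map_role uw.
exists v.
  by rewrite -map_comp; apply/eq_in_map => a _; apply: congr1 (decodeK (Ind a)).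
by split=> [B x|R x y] /chase_queryP[/sat].
Qed.

End ChaseQuery.

(** * Finitely branching submodels *)

Fixpoint subconcepts (C : concept) : seq concept :=
  C :: match C with
       | Top | Name _ => [::]
       | Neg D => subconcepts D
       | And D E => subconcepts D ++ subconcepts E
       | Ex _ D => subconcepts D
       end.

Definition tbox_concepts (T : tbox) : seq concept :=
  flatten [seq subconcepts ci.1 ++ subconcepts ci.2 | ci <- T].

Definition finitely_branching (I : interp) : Prop :=
  forall R (d : dom I), finite_set [set e | rint R d e].

Section Prune.
Variables (I : interp) (T : tbox) (A : abox).

Definition prune : interp := @Interp (anon I) (fun B d => @cint I B d)
  (fun R d e =>
     (exists a b, [/\ d = inl a, e = inl b & RAss R a b \in A]) \/
     (exists C, [/\ Ex R C \in tbox_concepts T, e = @succ_choice I d R C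
                  & @rint I R d e])).

Lemma prune_finitely_branching : finitely_branching prune.
Proof.
move=> R d; pose succ C := if C is Ex _ D then @succ_choice I d R D else d.
apply: (@sub_finite_set _ _
  (@indiv I @` [set` ind A] `|` succ @` [set` tbox_concepts T])).
  move=> _ /= [[a [b [_ -> /ind_role[_ bA]]]]|[C [CT -> _]]].
    by left; exists b.
  by right; exists (Ex R C).
by rewrite finite_setU; split; apply: finite_image.
Qed.

Lemma rint_prune R (d e : dom I) : sat_abox I A ->
  @rint prune R d e -> @rint I R d e.
Proof. by move=> [_ IR] [[a [b [-> -> /IR]]]|[C []]]. Qed.

Lemma cext_prune C (d : dom I) : sat_abox I A ->
  {subset subconcepts C <= tbox_concepts T} -> @cext prune C d <-> cext C d.
Proof.
move=> IA; elim: C d => [|B|D IHD|D IHD E IHE|R D IHD] d //= /forall_cons[CT sub].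
- by rewrite IHD.
- by rewrite IHD ?IHE // => x xD; apply: sub; rewrite mem_cat xD ?orbT.
- split=> [[e de /(IHD _ sub) De]|[e de De]].
    by exists e => //; apply: rint_prune.
  have [dw Dw] := @succ_choiceP I d R D (ex_intro2 _ _ e de De).
  exists (@succ_choice I d R D); last exact/IHD.
  by right; exists D.
Qed.

Lemma prune_model : model T A I -> model T A prune.
Proof.
move=> [IT IA]; have [IC IR] := IA; split; last first.
  by split=> [B a /IC //|R a b Rab]; left; exists a, b.
move=> C D CD d.
have sub x : x \in subconcepts C ++ subconcepts D -> x \in tbox_concepts T.
  by move=> xCD; apply/flatten_mapP; exists (C, D).
rewrite !cext_prune // => [|x xD|x xC]; first exact: IT.
  by apply: sub; rewrite mem_cat xD orbT.
by apply: sub; rewrite mem_cat xC.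
Qed.

End Prune.

(** * From entailment to embeddings *)

Section QueryLimit.
Variables (S : signature) (T : tbox) (A : abox) (J : interp).

Fixpoint reachable_at (t : elt) : set (dom J) :=
  match t with
  | Ind a => [set indiv J a]
  | Succ u R _ => \bigcup_(d in reachable_at u) [set e | rint R d e]
  end.

Lemma reachable_at_finite t : finitely_branching J -> finite_set (reachable_at t).
Proof.
by move=> finJ; elim: t => [a|u IHu R B] /=; [apply: finite_set1 | apply: bigcup_finite].
Qed.

Lemma chase_query_match_reachable m (v : var -> dom J) t n :
  (forall a, a \in ind A -> v (elt_code (Ind a)) = indiv J a) ->
  (forall R x y, RAtom R x y \in atoms (chase_query S T A m) -> rint R (v x) (v y)) ->
  con_elt S A t -> cdom (chase T A n) t -> elt_code t < m ->
  reachable_at t (v (elt_code t)).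
Proof.
move=> vI vR; elim: t => [a aA _ _|u IHu R B ct tdom tm]; first exact: vI.
exists (v (elt_code u)); last exact: vR (con_elt_parent_atom ct tdom tm).
exact: IHu ct.1 (cdom_parent tdom) (ltn_trans (elt_code_lt_Succ u R B) tm).
Qed.

Lemma chase_query_matches_hom : finitely_branching J ->
  (forall m, sat_cq J (chase_query S T A m) (ind A)) ->
  exists h : elt -> dom J, chase_hom S (chase_limit T A) (con_elt S A) h.
Proof.
move=> finJ matches.
have match_at m : exists v : var -> dom J,
    [/\ forall a, a \in ind A -> v (elt_code (Ind a)) = indiv J a,
        forall B x, CAtom B x \in atoms (chase_query S T A m) -> cint B (v x)
      & forall R x y, RAtom R x y \in atoms (chase_query S T A m) -> rint R (v x) (v y)].
  have [v va [vC vR]] := matches m; exists v; split=> // a aA.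
  by move: va; rewrite -map_comp => /eq_in_map; apply.
have [v vP] := choice match_at.
pose D t := con_elt S A t /\ cdom (chase_limit T A) t.
have [||U [h [UU ooU hU]]] :=
  @ultralimit_exists elt nat (dom J) \oo D reachable_at (fun m t => v m (elt_code t)).
- by move=> t _; apply: reachable_at_finite.
- move=> t [ct [n tdom]]; exists (elt_code t).+1 => // m tm.
  by have [vI _ vR] := vP m; apply: chase_query_match_reachable vI vR ct tdom tm.
have Ugt k : \forall m \near U, k < m by apply: ooU; exists k.+1.
exists h; split=> [a aA|B t SB ct [n Bt]|R t u SR ct cu [n tu]].
- have Da : D (Ind a) by split=> //; exists 0, a.
  have [m <-] := filter_ex (hU _ Da).
  by have [vI _ _] := vP m; apply: vI.
- have Dt : D t by split=> //; exists n; apply: cfact_dom Bt.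
  have [m [<- [Bm tm]]] :=
    filter_ex (filterI (hU _ Dt) (filterI (Ugt B) (Ugt (elt_code t)))).
  have [_ vC _] := vP m; apply: vC; apply/chase_queryP; split; first exact: ChaseConcept Bt.
  by apply/and3P.
- have [tdom udom] := rfact_dom tu.
  have Dt : D t by split=> //; exists n.
  have Du : D u by split=> //; exists n.
  have [m [[<- <-] [Rm [tm um]]]] := filter_ex (filterI (filterI (hU _ Dt) (hU _ Du))
    (filterI (Ugt R) (filterI (Ugt (elt_code t)) (Ugt (elt_code u))))).
  have [_ _ vR] := vP m; apply: vR; apply/chase_queryP; split; first exact: ChaseRole tu.
  by apply/and4P.
Qed.

End QueryLimit.

Lemma con_hom_embeddable_of_rcq_entails (T1 T2 : tbox) (Theta : signature * signature)
    (A : abox) (I : interp) :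
  rcq_entails Theta T1 T2 -> sig_abox Theta.1 A ->
  consistent T2 A -> model T1 A I ->
  con_hom_embeddable Theta.2 A (canonical_model T2 A) I.
Proof.
move=> ent sA cons2 IT1A; pose J := prune I T1 A.
have JT1A : model T1 A J by apply: prune_model.
have matches m : sat_cq J (chase_query Theta.2 T2 A m) (ind A).
  apply: ent JT1A => //; first by exists I.
  - exact: chase_query_rooted.
  - exact: chase_query_sig.
  - by rewrite size_map.
  - exact: chase_query_entailed.
have [h [hI hC hR]] := chase_query_matches_hom (@prune_finitely_branching I T1 A) matches.
apply: (@con_hom_embeddable_chase_hom _ _ _ I h); split=> // R t u SR ct cu tu.
by apply: (@rint_prune I T1 A); [case: IT1A | apply: hR].
Qed.

(** * Unravelling an ABox into a tree *)

(* A step (fwd, R, c) from b follows the edge R(b, c) if fwd holds and R(c, b)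
   otherwise.  A node is the list of steps leading to it from the root, last step
   first. *)
Definition step : Type := (bool * rname * iname)%type.
Definition node := seq step.

Definition node_code : node -> iname := pickle.
Definition node_decode (x : iname) : node := odflt [::] (unpickle x).

Lemma node_codeK : cancel node_code node_decode.
Proof. by move=> p; rewrite /node_decode /node_code pickleK. Qed.

Definition step_edge (s : step) (b c : iname) : assertion := orient s.1.1 (RAss s.1.2) b c.

Section Unravel.
Variables (A : abox) (sel : iname -> seq step) (b : iname).

Definition tip (p : node) : iname := if p is s :: _ then s.2 else b.

Fixpoint nodes (n : nat) : seq node :=
  [::] :: if n is m.+1
          then flatten [seq [seq s :: p | s <- sel (tip p)] | p <- nodes m]
          else [::].

Lemma nodes_nil n : [::] \in nodes n.
Proof. by case: n => [|n]; rewrite mem_head. Qed.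

Lemma nodes_cons n s p :
  (s :: p \in nodes n.+1) = (p \in nodes n) && (s \in sel (tip p)).
Proof.
rewrite /= inE /=; apply/flatten_mapP/andP => [[p' pn]|[pn sp]].
  by case/mapP=> s' s's [-> ->].
by exists p => //; apply: map_f.
Qed.

Lemma nodes_mono m n p : m <= n -> p \in nodes m -> p \in nodes n.
Proof.
elim: p m n => [|s p IHp] [|m] [|n] //; rewrite ?nodes_nil // !nodes_cons.
by move=> mn /andP[/(IHp m n mn) -> ->].
Qed.

Lemma nodes_consW n s p : s :: p \in nodes n -> p \in nodes n /\ s \in sel (tip p).
Proof.
by case: n => // n; rewrite nodes_cons => /andP[/(nodes_mono (leqnSn n))].
Qed.

Lemma nodes_extend n s p : p \in nodes n -> size p < n -> s \in sel (tip p) ->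
  s :: p \in nodes n.
Proof.
move=> pn sn sp; apply: (nodes_mono sn); rewrite nodes_cons sp andbT.
elim: p n pn {sn sp} => [|s' p IHp] n; first by rewrite nodes_nil.
by case: n => // n; rewrite !nodes_cons => /andP[/IHp-> ->].
Qed.

Definition copy_concept (p : node) (x : assertion) : option assertion :=
  if x is CAss B c then if c == tip p then Some (CAss B (node_code p)) else None else None.

Definition node_assertions (p : node) : seq assertion :=
  pmap (copy_concept p) A ++
  (if p is s :: p' then [:: step_edge s (node_code p') (node_code p)] else [::]).

Definition unravel (n : nat) : abox := flatten [seq node_assertions p | p <- nodes n].

Lemma unravel_concept n B x : CAss B x \in unravel n <->
  exists p, [/\ p \in nodes n, x = node_code p & CAss B (tip p) \in A].
Proof.
split=> [/flatten_mapP[p pn]|[p [pn -> Bp]]].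
  rewrite mem_cat mem_pmap => /orP[/mapP[[B' c|//] BcA] /=|]; last first.
    by case: p {pn} => // -[[[] R] c] p; rewrite inE => /eqP.
  by case: eqP => // cp [-> ->]; exists p; rewrite -cp.
apply/flatten_mapP; exists p => //; rewrite mem_cat mem_pmap; apply/orP; left.
by apply/mapP; exists (CAss B (tip p)); rewrite //= eqxx.
Qed.

Lemma unravel_step n s p : s :: p \in nodes n ->
  step_edge s (node_code p) (node_code (s :: p)) \in unravel n.
Proof.
by move=> spn; apply/flatten_mapP; exists (s :: p); rewrite // mem_cat mem_head orbT.
Qed.

Lemma unravel_role n R x y : RAss R x y \in unravel n ->
  exists s p, s :: p \in nodes n /\
    RAss R x y = step_edge s (node_code p) (node_code (s :: p)).
Proof.
case/flatten_mapP=> p pn; rewrite mem_cat mem_pmap => /orP[/mapP[[B c|//] _] /=|].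
  by case: ifP.
by case: p pn => // s p pn; rewrite inE => /eqP xy; exists s, p.
Qed.

Lemma unravel_edge n R x y : RAss R x y \in unravel n -> exists c,
  node_decode y = (true, R, c) :: node_decode x \/
  node_decode x = (false, R, c) :: node_decode y.
Proof.
by case/unravel_role=> -[[[] R'] c] [p [_ [-> -> ->]]]; exists c; rewrite !node_codeK; auto.
Qed.

Lemma ind_unravel n x : x \in ind (unravel n) -> exists2 p, p \in nodes n & x = node_code p.
Proof.
case/flatten_mapP=> -[B c|R c d].
  by case/unravel_concept=> p [pn -> _]; rewrite inE => /eqP->; exists p.
case/unravel_role=> -[[fwd R'] c'] [p [spn def]]; have [pn _] := nodes_consW spn.
case: fwd spn def => spn [_ -> ->]; rewrite !inE => /orP[] /eqP->; try by exists p.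
- by exists ((true, R', c') :: p).
- by exists ((false, R', c') :: p).
Qed.

Lemma adj_unravel n x y : adj (unravel n) x y -> exists s p, s :: p \in nodes n /\
  ((x = node_code p /\ y = node_code (s :: p)) \/
   (y = node_code p /\ x = node_code (s :: p))).
Proof.
case/adjP=> R [] /unravel_role[[[fwd R'] c] [p [spn def]]];
  by exists (fwd, R', c), p; split=> //; case: fwd def {spn} => -[_ -> ->]; auto.
Qed.

Definition node_parent (x : iname) : iname := node_code (behead (node_decode x)).

Lemma adj_node_parent n x y : adj (unravel n) x y ->
  (node_parent x = y /\ size (node_decode y) < size (node_decode x)) \/
  (node_parent y = x /\ size (node_decode x) < size (node_decode y)).
Proof.
by case/adj_unravel=> s [p [_ [[-> ->]|[-> ->]]]]; rewrite /node_parent !node_codeK; auto.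
Qed.

Lemma path_to_root n x : x \in ind (unravel n) ->
  exists2 p, path (adj (unravel n)) x p & last x p = node_code [::].
Proof.
case/ind_unravel=> p + ->; elim: p => [|s p IHp] spn; first by exists [::].
have [pn _] := nodes_consW spn; have [l pl lp] := IHp pn.
exists (node_code p :: l); rewrite //= pl andbT; apply/adjP.
exists s.1.2; have := unravel_step spn; rewrite /step_edge /orient.
by case: s.1.1 => ?; [right | left].
Qed.

Lemma unravel_tree n : ind (unravel n) != [::] -> tree_shaped (unravel n).
Proof.
move=> ind0.
have acyclic s s' x y : node_decode x = s :: node_decode y ->
    node_decode y = s' :: node_decode x -> False.
  by move=> -> /(congr1 size) /= /eqP; rewrite ltn_eqF //= ltnW.
split; first split=> //.
- exact: path_through_root (@adj_sym _) (@path_to_root n).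
- exact: size_parent_ucycle (@adj_node_parent n).
- move=> R S x y /unravel_edge[c xyR] SR; apply/negP => /unravel_edge[c' xyS].
  case: xyR xyS => xyR [] xyS; try exact: acyclic xyR xyS.
  + by move: xyR SR; rewrite xyS => -[->].
  + by move: xyR SR; rewrite xyS => -[->].
- move=> R S x y /unravel_edge[c xyR]; apply/negP => /unravel_edge[c' yxS].
  case: xyR yxS => xyR [] yxS; try exact: acyclic xyR yxS.
  + by move: xyR; rewrite yxS.
  + by move: xyR; rewrite yxS.
Qed.

Lemma child_unravel n p x : child (unravel n) (node_code [::]) (node_code p) x ->
  exists2 s, s \in sel (tip p) & x = node_code (s :: p).
Proof.
case=> /adj_unravel[s [q [sqn pq]]] [l [pl lp xl]].
case: pq => [[/(can_inj node_codeK)-> ->]|[xq pq]].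
  by have [_ sq] := nodes_consW sqn; exists s.
have := parent_last_avoid (@adj_node_parent n) _ pl xl.
by rewrite lp pq /node_parent !node_codeK xq => /(_ erefl).
Qed.

Lemma unravel_outdegree n k : node_code [::] \in ind (unravel n) ->
  (forall c, size (sel c) <= k) -> outdegree_le k (unravel n).
Proof.
move=> root_ind selk; exists (node_code [::]) => // x cs /ind_unravel[p pn ->] Ucs csP.
apply: leq_trans (selk (tip p)); rewrite -(size_map (fun s => node_code (s :: p))).
apply: uniq_leq_size => // c /csP /child_unravel[s sp ->].
by apply/mapP; exists s.
Qed.

Hypothesis sel_abox : forall c s, s \in sel c -> step_edge s c s.2 \in A.

Lemma unravel_hom n : abox_hom (tip \o node_decode) (unravel n) A.
Proof.
split=> [B x /unravel_concept[p [_ -> Bp]]|R x y /unravel_role[s [p [spn xy]]]].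
  by rewrite /= node_codeK.
have [_ /sel_abox] := nodes_consW spn.
by case: s xy {spn} => -[[] R'] c [-> -> ->]; rewrite /= !node_codeK.
Qed.

Lemma root_in_unravel n : b \in ind A -> (forall c, adj A b c -> sel b <> [::]) ->
  node_code [::] \in ind (unravel n.+1).
Proof.
move=> /ind_inv[[B Bb] _|[c /[swap] /[apply]]].
  by apply: (@ind_concept _ B); apply/unravel_concept; exists [::]; rewrite nodes_nil.
case E: (sel b) => [//|s l] _.
have /unravel_step : [:: s] \in nodes n.+1 by rewrite nodes_cons nodes_nil E mem_head.
by case: s {E} => -[[] R] d => /ind_role[].
Qed.

(* A round of the chase looks only one step further along the ABox, so a node at
   depth d of an unravelling of depth n simulates its tip for n - d rounds. *)
Definition node_simulates (J : interp) (n k : nat) (a : iname) (x : dom J) : Prop :=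
  exists p, [/\ p \in nodes n, size p + k <= n, tip p = a & x = indiv J (node_code p)].

Lemma unravel_simulation (T : tbox) (J : interp) (n : nat) :
  sat_abox J (unravel n) ->
  (forall c k fwd R D d, (fwd, R, D) \in edge_premises T ->
     orient fwd (RAss R) c d \in A -> cfact (chase T A k) D (Ind d) ->
     exists2 d', (fwd, R, d') \in sel c & cfact (chase T A k) D (Ind d')) ->
  simulation T A (@node_simulates J n).
Proof.
move=> [JC JR] sel_edge; split=> [k a x|k a x B|k a x fwd R D c].
- by case=> p [pn pk pa xp]; exists p; split=> //; apply: leq_trans pk; rewrite addnS.
- by case=> p [pn _ <- ->] Ba; apply: JC; apply/unravel_concept; exists p.
- case=> p [pn pk <- ->] FRD ac Dc; have [d sd Dd] := sel_edge _ _ _ _ _ _ FRD ac Dc.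
  have spn : (fwd, R, d) :: p \in nodes n.
    by apply: nodes_extend sd => //; apply: leq_trans pk; rewrite addnS ltnS leq_addr.
  exists d, (indiv J (node_code ((fwd, R, d) :: p))); split=> //.
    by exists ((fwd, R, d) :: p); rewrite /= addSnnS.
  by move: (unravel_step spn); case: (fwd) => /JR.
Qed.

End Unravel.

Definition name_map (I : interp) (g : iname -> iname) (x : iname + dom I) : dom I :=
  match x with inl a => indiv I (g a) | inr d => d end.

(* The domain of I with additional copies of the individuals, so that each name a
   denotes a copy of g a. *)
Definition rename (I : interp) (g : iname -> iname) : interp := @Interp (dom I)
  (fun B x => cint B (name_map g x))
  (fun R x y => rint R (name_map g x) (name_map g y)).

Lemma cext_rename I g C (x : dom (rename I g)) : cext C x <-> cext C (name_map g x).
Proof.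
elim: C x => [|B|D IHD|D IHD E IHE|R D IHD] x //=.
- by rewrite IHD.
- by rewrite IHD IHE.
- split=> [[y xy /IHD Dy]|[d xd Dd]]; first by exists (name_map g y).
  by exists (inr d) => //; apply/IHD.
Qed.

Lemma model_rename T A A' I g : abox_hom g A' A -> model T A I -> model T A' (rename I g).
Proof.
move=> [gC gR] [IT [IC IR]]; split=> [C D CD x /cext_rename Cx|].
  by apply/cext_rename; apply: IT CD _ Cx.
by split=> [B a /gC /IC|R a c /gR /IR].
Qed.

Lemma consistent_hom T A A' g : abox_hom g A' A -> consistent T A -> consistent T A'.
Proof. by move=> gA' [I IA]; exists (rename I g); apply: model_rename IA. Qed.

(** * Selecting the neighbours that matter for the chase *)

Section Selection.
Variables (T : tbox) (A : abox).

Definition earliest (b : iname) (fwd : bool) (R : rname) (D : concept) (c : iname) : Prop :=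
  forall n d, orient fwd (RAss R) b d \in A ->
    cfact (chase T A n) D (Ind d) -> cfact (chase T A n) D (Ind c).

Definition earliest_step (b : iname) (e : bool * rname * concept) : option step :=
  let: (fwd, R, D) := e in
  if pselect (exists2 c, orient fwd (RAss R) b c \in A & earliest b fwd R D c) is left ex
  then Some (fwd, R, projT1 (cid2 ex)) else None.

Lemma earliest_step_exists b n fwd R D c :
  orient fwd (RAss R) b c \in A -> cfact (chase T A n) D (Ind c) ->
  exists2 d, earliest_step b (fwd, R, D) = Some (fwd, R, d) & cfact (chase T A n) D (Ind d).
Proof.
move=> bc Dc.
have exE : exists2 d, orient fwd (RAss R) b d \in A & earliest b fwd R D d.
  apply: (@earliest_witness _ (fun d => orient fwd (RAss R) b d \in A)
    (fun m d => cfact (chase T A m) D (Ind d))); last by exists n, c.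
  by move=> m k d; apply: cfact_mono.
rewrite /earliest_step; case: pselect => // ex; exists (projT1 (cid2 ex)) => //.
by case: cid2 => d /= _ /(_ n c bc Dc).
Qed.

Definition step_from (b : iname) (x : assertion) : option step :=
  if x is RAss R c d then
    if c == b then Some (true, R, d) else if d == b then Some (false, R, c) else None
  else None.

(* One arbitrary neighbour is added so that the root of an unravelling is an
   individual of it even if it satisfies no concept assertion. *)
Definition relevant_steps (b : iname) : seq step :=
  take 1 (pmap (step_from b) A) ++ pmap (earliest_step b) (edge_premises (undup T)).

Lemma relevant_steps_abox b s : s \in relevant_steps b -> step_edge s b s.2 \in A.
Proof.
rewrite mem_cat => /orP[/mem_take|]; rewrite mem_pmap => /mapP[].
  case=> // R c d cdA /=; case: eqP => [<- [->] //|_].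
  by case: eqP => [<- [->]|].
move=> [[fwd R] D] _ /=; case: pselect => // ex [->].
by case: cid2.
Qed.

Lemma mem_edge_premises_undup : edge_premises (undup T) =i edge_premises T.
Proof.
move=> e; rewrite !mem_pmap; apply: eq_mem_map => x.
by apply/mem_normal_form/mem_normal_form => -[ci];
  rewrite ?mem_undup => ciT xci; exists ci; rewrite ?mem_undup.
Qed.

Lemma relevant_steps_edge b n fwd R D c :
  (fwd, R, D) \in edge_premises T -> orient fwd (RAss R) b c \in A ->
  cfact (chase T A n) D (Ind c) ->
  exists2 d, (fwd, R, d) \in relevant_steps b & cfact (chase T A n) D (Ind d).
Proof.
move=> FRD bc Dc; have [d bd Dd] := earliest_step_exists bc Dc; exists d => //.
rewrite mem_cat mem_pmap; apply/orP; right; apply/mapP; exists (fwd, R, D) => //.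
by rewrite mem_edge_premises_undup.
Qed.

Lemma relevant_steps_neq0 b c : adj A b c -> relevant_steps b <> [::].
Proof.
move=> /adjP[R bc]; have [s] : exists s, s \in pmap (step_from b) A.
  case: bc => bcA; first exists (true, R, c).
    by rewrite mem_pmap; apply/mapP; exists (RAss R b c); rewrite //= eqxx.
  have [cb|cb] := eqVneq c b; first exists (true, R, b).
    by rewrite mem_pmap; apply/mapP; exists (RAss R c b); rewrite //= cb eqxx.
  exists (false, R, c); rewrite mem_pmap; apply/mapP; exists (RAss R c b) => //=.
  by rewrite (negPf cb) eqxx.
by rewrite /relevant_steps; case: (pmap _ A).
Qed.

Lemma size_norm_neg_premises C : size (pmap edge_premise (norm_neg C)) <= concept_size C.
Proof.
elim: C => [||D _|D IHD E IHE|R D IHD] //=; last exact: leqW.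
by rewrite pmap_cat size_cat; apply/leqW/leq_add.
Qed.

Lemma size_norm_pos_premises C : size (pmap edge_premise (norm_pos C)) <= concept_size C.
Proof.
elim/positive_concept_ind: C => [||R D IHD|D nall|D E IHD IHE|R D IHD] //.
- by rewrite /= ltnS; do 3!apply: leqW.
- by rewrite norm_pos_Neg //=; apply/leqW/size_norm_neg_premises.
- by rewrite /= pmap_cat size_cat; apply/leqW/leq_add.
- by rewrite /=; do 2!apply: leqW.
Qed.

Lemma size_edge_premises U :
  size (edge_premises U) + size U <=
  \sum_(ci <- U) (concept_size ci.1 + concept_size ci.2).+1.
Proof.
elim: U => [|[C D] U IHU]; first by rewrite big_nil.
have -> : edge_premises ((C, D) :: U) = (pmap edge_premise (norm_neg C) ++
    pmap edge_premise (norm_pos D)) ++ edge_premises U by rewrite -!pmap_cat.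
rewrite big_cons !size_cat /= addnS addSn ltnS -addnA.
by apply: leq_add IHU; rewrite leq_add ?size_norm_neg_premises ?size_norm_pos_premises.
Qed.

Lemma size_relevant_steps b : T <> [::] -> size (relevant_steps b) <= tbox_size T.
Proof.
move=> T_neq0; rewrite size_cat addnC; apply: leq_trans (size_edge_premises (undup T)).
apply: leq_add; first by rewrite size_pmap count_size.
rewrite size_take_min; apply: leq_trans (geq_minl _ _) _.
by rewrite lt0n size_eq0; apply/eqP => /undup_nil.
Qed.

End Selection.

(** * From embeddings to entailment *)

Section SimulationHom.
Variables (S : signature) (T : tbox) (A A' : abox) (I J : interp) (n : nat) (b : iname).
Variables (P : nat -> iname -> dom J -> Prop) (x0 : dom J) (f : dom J -> dom I).
Hypotheses (JT : sat_tbox J T) (P_sim : simulation T A P).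
Hypotheses (Px0 : P n b x0) (x0_con : con_dom S A' x0).
Hypotheses (IA : sat_abox I A) (f_root : f x0 = indiv I b).
Hypothesis f_concept : forall B d, sigC S B -> con_dom S A' d -> cint B d -> cint B (f d).
Hypothesis f_role : forall R d e, sigR S R -> con_dom S A' d -> con_dom S A' e ->
  rint R d e -> rint R (f d) (f e).

Lemma tree_map_con_dom t : con_elt S A t -> elt_root t = b -> cdom (chase T A n) t ->
  con_dom S A' (tree_map x0 t).
Proof.
elim: t => [a|u IHu R B] //= [cu SR] ub tdom.
apply: con_step (IHu cu ub (cdom_parent tdom)) SR _.
by apply: (tree_map_role JT P_sim _ (cdom_rfact tdom)); rewrite ub.
Qed.

Lemma simulation_chase_hom :
  chase_hom S (chase T A n) (con_tree S A b) (fun t => f (tree_map x0 t)).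
Proof.
split=> [a [_ /= ->]|B t SB [ct tb] Bt|R t u SR [ct tb] [cu ub] tu] //.
  have tdom := cfact_dom Bt.
  apply: f_concept => //; first exact: tree_map_con_dom.
  by apply: (tree_map_concept JT P_sim _ Bt); rewrite tb.
have [tdom udom] := rfact_dom tu.
have [[a [c [ta uc Rac]]]|[B [m [_ uB _]]]] := rfact_inv tu.
  have Rbb : RAss R b b \in A by rewrite -{1}tb -ub ta uc.
  by rewrite ta uc /= f_root; apply: IA.2 Rbb.
subst u; apply: f_role => //; try exact: tree_map_con_dom.
by apply: (tree_map_role JT P_sim _ tu); rewrite tb.
Qed.

End SimulationHom.

Definition tree_embeddings (Theta : signature * signature) (T1 T2 : tbox) : Prop :=
  forall A : abox,
    sig_abox Theta.1 A -> tree_shaped A -> outdegree_le (tbox_size T2) A ->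
    consistent T1 A -> consistent T2 A ->
    forall I : interp, model T1 A I ->
      con_hom_embeddable Theta.2 A (canonical_model T2 A) I.

Section EmbeddingsToEntailment.
Variables (T1 T2 : tbox) (Theta : signature * signature).
Hypotheses (hornT2 : horn T2) (embed : tree_embeddings Theta T1 T2).
Variables (A : abox) (I : interp).
Hypotheses (sA : sig_abox Theta.1 A) (cons2 : consistent T2 A) (I_model : model T1 A I).

Lemma tree_chase_hom_exists n b : T2 <> [::] -> b \in ind A ->
  exists h : elt -> dom I, chase_hom Theta.2 (chase T2 A n) (con_tree Theta.2 A b) h.
Proof.
move=> T2_neq0 bA; pose A' := unravel A (relevant_steps T2 A) b n.+1.
pose g := tip b \o node_decode.
have A'_hom : abox_hom g A' A by apply: unravel_hom; apply: relevant_steps_abox.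
have root_ind : node_code [::] \in ind A'.
  exact: root_in_unravel bA (@relevant_steps_neq0 T2 A b).
have IA' : model T1 A' (rename I g) := model_rename A'_hom I_model.
have cons2' : consistent T2 A' := consistent_hom A'_hom cons2.
pose J := canonical_model T2 A'.
have [JT JA'] : model T2 A' J by apply: canonical_model_is_model.
have [f [fC fR fI]] : con_hom_embeddable Theta.2 A' J (rename I g).
  apply: embed => //; last by exists (rename I g).
  - exact: abox_hom_sig A'_hom sA.
  - by apply: unravel_tree; apply: contraL root_ind => /eqP->.
  - by apply: unravel_outdegree root_ind _ => c; apply: size_relevant_steps.
have J_sim : simulation T2 A (@node_simulates (relevant_steps T2 A) b J n.+1).
  by apply: unravel_simulation => // c k fwd R D d; apply: relevant_steps_edge.
pose root := indiv J (node_code [::]).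
have root_con : con_dom Theta.2 A' root by apply: con_ind.
exists (fun t => name_map g (f (tree_map root t))).
apply: (@simulation_chase_hom _ _ _ A' I J n b _ root (name_map g \o f) JT J_sim) => //.
- by exists [::]; rewrite nodes_nil.
- exact: I_model.2.
- by rewrite /= [f _]fI.
Qed.

Lemma chase_hom_exists n : exists h : elt -> dom I,
  chase_hom Theta.2 (chase T2 A n) (con_elt Theta.2 A) h.
Proof.
have [T2_nil|T2_neq0] := pselect (T2 = [::]); last first.
  by apply: chase_hom_glue I_model.2 _ => b; apply: tree_chase_hom_exists.
exists (chase_map I); apply: chase_map_chase_hom; split; last exact: I_model.2.
by rewrite T2_nil.
Qed.

End EmbeddingsToEntailment.

Lemma rcq_entails_of_tree_embeddings (T1 T2 : tbox) (Theta : signature * signature) :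
  horn T2 -> tree_embeddings Theta T1 T2 -> rcq_entails Theta T1 T2.
Proof.
move=> hornT2 embed A sA _ cons2 q a rooted_q sig_q _ aA ent I IA.
have [n sat_q] : exists n, forall (J : interp) (h : elt -> dom J),
    chase_hom Theta.2 (chase T2 A n) (con_elt Theta.2 A) h -> sat_cq J q a.
  apply: sat_cq_canonical_stage => //.
  exact: ent (canonical_model_is_model hornT2 cons2).
by have [h /sat_q] := chase_hom_exists hornT2 embed sA cons2 IA n.
Qed.

Theorem theorem10 (T1 T2 : tbox) (Theta : signature * signature)
    (hornT2 : horn T2) :
  rcq_entails Theta T1 T2 <->
  (forall A : abox,
     sig_abox Theta.1 A -> tree_shaped A -> outdegree_le (tbox_size T2) A ->
     consistent T1 A -> consistent T2 A ->
     forall I1 : interp, model T1 A I1 ->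
       con_hom_embeddable Theta.2 A (canonical_model T2 A) I1).
Proof.
split; last exact: rcq_entails_of_tree_embeddings.
move=> ent A sA _ _ _ cons2 I1 I1A.
exact: con_hom_embeddable_of_rcq_entails ent sA cons2 I1A.
Qed.
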